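(* Let $w$ be a positive word in $a,b$ which is not a power of $a$ or of $b$. Then there is a function $\sigma_w$, depending only on $w$, from the set of positive divisors of $h_a(w)$ to the positive rational numbers, such that $g\cdot\sigma_w(g)$ is an integer for every positive divisor $g$ of $h_a(w)$, and such that for every reduced fraction $p/q$ (i.e. $p,q\in\mathbb{Z}$, $q\ge 1$, $\gcd(p,q)=1$), writing $g:=\gcd(q,h_a(w))$, $$\mathrm{fr}_w(p/q)=\frac{1}{\sigma_w(g)\cdot q}.$$
   Context: $\mathrm{Homeo}_+^\sim(S^1)$ is the group of orientation-preserving homeomorphisms of $\mathbb{R}$ commuting with the translation $x\mapsto x+1$. For $f\in \mathrm{Homeo}_+^\sim(S^1)$, the (real-valued) rotation number is $\mathrm{rot}^\sim(f)=\lim_{n\to\infty} f^n(0)/n\in\mathbb{R}$. $F$ is the free group on $a,b$. A word $w\in F$ is positive if it lies in the semigroup generated by $a$ and $b$ (only positive powers occur); $h_a(w)$ and $h_b(w)$ denote the numbers of $a$'s and $b$'s in $w$. For $r,s\in\mathbb{R}$, $R(w;r,s)$ is the maximum of $\mathrm{rot}^\sim(\rho(w))$ over all homomorphisms $\rho:F\to\mathrm{Homeo}_+^\sim(S^1)$ with $\mathrm{rot}^\sim(\rho(a))=r$ and $\mathrm{rot}^\sim(\rho(b))=s$ (the maximum is known to be attained). It is known (Calegari-Walker) that for $w$ positive and not a power of $a$ or $b$, and $r$ rational, there is a least rational number $s\in[0,1)$ such that $R(w;r,t)=h_a(w)r+h_b(w)$ for all $t\in[s,1)$. The fringe length of $r$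 is $\mathrm{fr}_w(r):=1-s$. *)

(* Defs.v *)
From HB Require Import structures.
From mathcomp Require Import all_boot all_order all_algebra.
From mathcomp Require Import all_classical all_reals all_analysis.

Set Implicit Arguments.
Unset Strict Implicit.
Unset Printing Implicit Defensive.

Import Order.TTheory GRing.Theory Num.Theory.
Import numFieldNormedType.Exports.
Local Open Scope classical_set_scope.
Local Open Scope ring_scope.

(* F is realized as the set of reduced words. The letter (x, e) is the
   generator a if x = false and b if x = true, inverted if e = true. *)
Definition letter : Type := (bool * bool)%type.

Definition linv (x : letter) : letter := (x.1, ~~ x.2).

Definition reduced (s : seq letter) : bool :=
  sorted (fun x y => y != linv x) s.

Definition push (x : letter) (s : seq letter) : seq letter :=
  if s is y :: s' then if y == linv x then s' else x :: s else [:: x].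

Lemma linvK : involutive linv.
Proof. by case=> x e; rewrite /linv /= negbK. Qed.

Lemma reduced_push x s : reduced s -> reduced (push x s).
Proof.
case: s => [|y s] //= ys; case: ifPn => [_|yx]; first exact: path_sorted ys.
by rewrite /reduced /= yx.
Qed.

Lemma pushK x s : reduced s -> push x (push (linv x) s) = s.
Proof.
case: s => [|y s] /=; first by rewrite eqxx.
rewrite linvK; have [->|yx] := eqVneq y x; last by rewrite /= eqxx.
by case: s => [|z s] //= /andP[/negPf ->].
Qed.

Record freeF := FreeF { word_of :> seq letter ; _ : reduced word_of }.

HB.instance Definition _ := [isSub for word_of].
HB.instance Definition _ := [Choice of freeF by <:].

Lemma word_ofP (u : freeF) : reduced u. Proof. by case: u. Qed.

Lemma reduced_mul (u v : freeF) : reduced (foldr push v u).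
Proof.
by elim: (word_of u) => [|x s IHs] /=; [exact: word_ofP|exact: reduced_push].
Qed.

Lemma reduced_inv (u : freeF) : reduced (rev (map linv u)).
Proof.
rewrite /reduced rev_sorted sorted_map.
apply: sub_sorted (word_ofP u) => x y /=; apply: contraNN => /eqP ->.
by rewrite !linvK.
Qed.

Definition fone : freeF := @FreeF [::] isT.
Definition fmul (u v : freeF) : freeF := FreeF (reduced_mul u v).
Definition finv (u : freeF) : freeF := FreeF (reduced_inv u).

Lemma foldr_push s t (v : freeF) :
  foldr push v (foldr push t s) = foldr push (foldr push v t) s.
Proof.
elim: s => [|x s IHs] //=; rewrite -IHs.
case: (foldr push t s) => [|y r] //=; case: ifPn => //= /eqP ->.
rewrite pushK //; elim: r => [|z r IHr] /=; first exact: word_ofP.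
exact: reduced_push.
Qed.

Lemma fmulA : associative fmul.
Proof. by move=> u v w; apply: val_inj; rewrite /= foldr_push. Qed.

Lemma fmul1 : left_id fone fmul.
Proof. by move=> u; apply: val_inj. Qed.

Lemma fmulr1 : right_id fone fmul.
Proof.
move=> [u ru]; apply: val_inj => /=; elim: u ru => [|x u IHu] //= xu.
rewrite IHu; last exact: path_sorted xu.
by case: u xu {IHu} => [|y u] //= /andP[/negPf ->].
Qed.

Lemma fmulV : left_inverse fone finv fmul.
Proof.
move=> [u ru]; apply: val_inj => /=; elim: u {ru} => [|x u IHu] //=.
by rewrite rev_cons foldr_rcons /= linvK eqxx.
Qed.

Lemma finvK : involutive finv.
Proof.
move=> [u ru]; apply: val_inj => /=.
by rewrite map_rev revK -map_comp map_id_in // => x _; rewrite /= linvK.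
Qed.

Lemma fmulrV : right_inverse fone finv fmul.
Proof. by move=> u; rewrite -{1}[u]finvK fmulV. Qed.

HB.instance Definition _ :=
  isGroup.Build freeF fmulA fmul1 fmulr1 fmulV fmulrV.

Definition gen_a : freeF := @FreeF [:: (false, false)] isT.
Definition gen_b : freeF := @FreeF [:: (true, false)] isT.

Inductive positive : freeF -> Prop :=
| positive_a : positive gen_a
| positive_b : positive gen_b
| positive_mul u v : positive u -> positive v -> positive (u * v)%g.

Definition h_a (w : freeF) : nat := count_mem (false, false) (word_of w).
Definition h_b (w : freeF) : nat := count_mem (true, false) (word_of w).

Section Homeo.
Variable R : realType.

Record homeo := Homeo {
  hfun :> R -> R ;
  hinv : R -> R ;
  hfunK : cancel hfun hinv ;
  hinvK : cancel hinv hfun ;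
  hfun_continuous : continuous hfun ;
  hinv_continuous : continuous hinv ;
  hfun_incr : {homo hfun : x y / x < y} ;
  hfunD1 : forall x, hfun (x + 1) = hfun x + 1 }.

HB.instance Definition _ := gen_eqMixin homeo.
HB.instance Definition _ := gen_choiceMixin homeo.

Lemma homeo_eq (f g : homeo) : f =1 g -> f = g.
Proof.
case: f g => [f f' fK f'K fc f'c fi f1] [g g' gK g'K gc g'c gi g1] /= /funext fg.
subst g; have f'g' : f' = g' by apply/funext => x; rewrite -{1}(g'K x) fK.
by subst g'; congr Homeo; exact: Prop_irrelevance.
Qed.

Definition homeo1 : homeo.
Proof.
by refine (@Homeo id id _ _ _ _ _ _) => // x; exact: cvg_id.
Defined.

Definition homeoM (f g : homeo) : homeo.
Proof.
refine (@Homeo (f \o g) (hinv g \o hinv f) _ _ _ _ _ _).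
- by move=> x /=; rewrite !hfunK.
- by move=> x /=; rewrite !hinvK.
- by move=> x; apply: continuous_comp; exact: hfun_continuous.
- by move=> x; apply: continuous_comp; exact: hinv_continuous.
- by move=> x y xy /=; do 2 apply: hfun_incr.
- by move=> x /=; rewrite !hfunD1.
Defined.

Definition homeoV (f : homeo) : homeo.
Proof.
refine (@Homeo (hinv f) f (@hinvK f) (@hfunK f)
  (@hinv_continuous f) (@hfun_continuous f) _ _).
- move=> x y; apply: contraTT; rewrite -!leNgt le_eqVlt => /orP[/eqP yx|].
    by rewrite -(hinvK f x) -(hinvK f y) yx.
  by move=> /(@hfun_incr f); rewrite !hinvK => /ltW.
- by move=> x; apply: (can_inj (hfunK f)); rewrite hfunD1 !hinvK.
Defined.

Lemma homeoMA : associative homeoM.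
Proof. by move=> f g h; exact: homeo_eq. Qed.

Lemma homeo1M : left_id homeo1 homeoM.
Proof. by move=> f; exact: homeo_eq. Qed.

Lemma homeoM1 : right_id homeo1 homeoM.
Proof. by move=> f; exact: homeo_eq. Qed.

Lemma homeoVM : left_inverse homeo1 homeoV homeoM.
Proof. by move=> f; apply: homeo_eq => x; exact: hfunK. Qed.

Lemma homeoMV : right_inverse homeo1 homeoV homeoM.
Proof. by move=> f; apply: homeo_eq => x; exact: hinvK. Qed.

HB.instance Definition _ :=
  isGroup.Build homeo homeoMA homeo1M homeoM1 homeoVM homeoMV.

Definition rot (f : homeo) : R :=
  limn (fun n : nat => iter n f 0 / n%:R).

(* [is_R w r s m] means R(w; r, s) = m. *)
Definition is_R (w : freeF) (r s m : R) : Prop :=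
  (exists rho : {multiplicative freeF -> homeo},
     [/\ rot (rho gen_a) = r, rot (rho gen_b) = s & rot (rho w) = m]) /\
  (forall rho : {multiplicative freeF -> homeo},
     rot (rho gen_a) = r -> rot (rho gen_b) = s -> rot (rho w) <= m).

Definition fringe_set (w : freeF) (r : rat) : set rat :=
  [set s | 0 <= s < 1 /\
     forall t : R, ratr s <= t < 1 ->
       is_R w (ratr r) t ((h_a w)%:R * ratr r + (h_b w)%:R)].

(* [is_fringe_length w r l] means fr_w(r) = l. *)
Definition is_fringe_length (w : freeF) (r l : rat) : Prop :=
  exists s : rat,
    [/\ fringe_set w r s, lbound (fringe_set w r) s & l = 1 - s].

End Homeo.

(* Main.v *)
Require Import Defs.
From HB Require Import structures.
From mathcomp Require Import all_boot all_order all_algebra.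
From mathcomp Require Import all_classical all_reals all_analysis.
From mathcomp Require Import zify ring lra.

(** Let [h = h_a w].  Up to conjugation [w] is a product of blocks [a b^(beta k)]
    for [k < h], so its rotation number is that of such a product.

    When [rot b < 1] every point satisfies [b x < x + 1].  Replacing each [b] by
    the translation by 1 therefore only increases the word, and its rotation number
    is at most [h_a r + h_b].  The question is for which [t] this is attained.

    Take [r = p/q] and suppose that it is attained.  The map [a] has a periodic
    orbit with [q] points on the circle; number the gaps of its lift to the line by
    integers.  Then [a] adds [p] to the number of a gap and [x + 1] adds [q].  Since
    [w^q] advances some point by exactly [h p + q h_b], along the orbit of that
    point no [b] may fall behind the gap that the translation by 1 would reach
    ([rot_ge_of_maximum]).  So the gap reached after [K] blocks, whose number is
    [K p] up to a constant and a multiple of [q], contains a point for which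
    [beta K] applications of [b - 1] stay in the gap.  The [K]'s leading to the
    gap [j] run over a class modulo [q], and [beta] has period [h], so all [beta k]
    with [k] in one class modulo [g = gcd(q, h)] occur; let [M j] be the largest.
    In every gap [M j] applications of [b - 1] go back by at most one gap, so with
    [V] the sum of the [M j], [V] applications move some orbit back by at
    most one full turn, which means [rot b >= 1 - 1/V].

    Conversely, for [1 - 1/V <= t < 1] there are [a] and [b] for which the orbit of
    one point never loses a gap ([maximum_exists]): [a] pushes the quarter point of
    each gap to the three quarter point of its image, and [b - 1] takes at least
    [M j] steps to come back from the three quarter point to the quarter point.

    Hence the least [s] is [1 - 1/V] and the fringe length is [1/V].  As [j] runs
    over the residues modulo [q], each class modulo [g] is met [q/g] times, so
    [V = sigma(g) q] where [g sigma(g)] is the sum over the classes modulo [g] of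
    the longest run of [b]'s in the class. *)

Set Implicit Arguments.
Unset Strict Implicit.
Unset Printing Implicit Defensive.

Import Order.TTheory GRing.Theory Num.Theory.
Import numFieldNormedType.Exports.
Local Open Scope classical_set_scope.
Local Open Scope ring_scope.
Local Notation rot := Defs.rot.

(** * Rotation numbers *)

Section RotationNumber.
Variable R : realType.
Implicit Types (f g : homeo R) (x y c C : R).

Lemma homeo_le f x y : (f x <= f y) = (x <= y).
Proof. exact: (le_mono (@hfun_incr R f)). Qed.

Lemma homeo_natD f x (n : nat) : f (x + n%:R) = f x + n%:R.
Proof.
by elim: n => [|n IHn]; rewrite ?addr0 // -natr1 !addrA hfunD1 IHn.
Qed.

Lemma homeo_intD f x (n : int) : f (x + n%:~R) = f x + n%:~R.
Proof.
case: n => n; first exact: homeo_natD.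
rewrite NegzE mulrNz; apply/eqP; rewrite eq_sym subr_eq -homeo_natD.
by rewrite -addrA addNr addr0.
Qed.

Lemma homeo1_app x : (1%g : homeo R) x = x. Proof. by []. Qed.

Lemma homeoM_app f g x : (f * g)%g x = f (g x). Proof. by []. Qed.

Lemma homeoV_app f x : (f^-1)%g (f x) = x. Proof. exact: hfunK. Qed.

Lemma homeo_iter f n x : (f ^+ n)%g x = iter n f x.
Proof. by elim: n => // n IHn; rewrite expgS homeoM_app IHn iterS. Qed.

Lemma iter_intD f x (N : int) n :
  f x = x + N%:~R -> (f ^+ n)%g x = x + (n%:Z * N)%:~R.
Proof.
move=> fx; elim: n => [|n IHn]; first by rewrite mul0r addr0.
rewrite expgSr homeoM_app fx homeo_intD IHn -addrA -intrD.
by rewrite intS mulrDl mul1r (addrC N).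
Qed.

(** Displacements of one homeomorphism at two points differ by at most 1: both
    are compared with the displacement at a common integer translate. *)
Lemma displacement_le f x y : f x - x <= f y - y + 1.
Proof.
have : f x <= f (y + (Num.ceil (x - y))%:~R).
  by rewrite homeo_le; have := Num.Theory.ceil_ge (x - y); lra.
rewrite homeo_intD.
have := @Num.Theory.ceilB1_lt _ (x - y); rewrite ?num_real // intrB; lra.
Qed.

Lemma iter_ge_add f n (m : nat) x c : (forall y, y + c <= (f ^+ n)%g y) ->
  x + m%:R * c <= (f ^+ (m * n))%g x.
Proof.
move=> fc; elim: m x => [|m IHm] x; first by rewrite mul0r addr0.
rewrite mulSn expgnDr homeoM_app -natr1.
by have := fc ((f ^+ (m * n))%g x); have := IHm x; lra.
Qed.

Lemma iter_le_add f n (m : nat) x c : (forall y, (f ^+ n)%g y <= y + c) ->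
  (f ^+ (m * n))%g x <= x + m%:R * c.
Proof.
move=> fc; elim: m x => [|m IHm] x; first by rewrite mul0r addr0.
rewrite mulSn expgnDr homeoM_app -natr1.
by have := fc ((f ^+ (m * n))%g x); have := IHm x; lra.
Qed.

Lemma iter_mul_bounds f (m n : nat) :
  m%:R * ((f ^+ n)%g 0 - 1) <= (f ^+ (m * n))%g 0 <=
  m%:R * ((f ^+ n)%g 0 + 1).
Proof.
apply/andP; split.
  rewrite -[leLHS]add0r; apply: iter_ge_add => y.
  by have := displacement_le (f ^+ n)%g 0 y; lra.
rewrite -[leRHS]add0r; apply: iter_le_add => y.
by have := displacement_le (f ^+ n)%g y 0; lra.
Qed.

(** The number approximated by all the quotients [f^n(0) / n] with error [1 / n]
    is the supremum of their lower bounds, each of which is below every upper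
    bound by comparing [f^(mn)] with both [f^m] and [f^n]. *)
Lemma rot_exists f :
  exists c, forall n, `|(f ^+ n)%g 0 - n%:R * c| <= 1.
Proof.
pose lo n := ((f ^+ n.+1)%g 0 - 1) / n.+1%:R.
pose hi n := ((f ^+ n.+1)%g 0 + 1) / n.+1%:R.
have lohi m n : lo n <= hi m.
  rewrite /lo /hi ler_pdivrMr ?ltr0n // mulrAC ler_pdivlMr ?ltr0n //.
  have /andP[A _] := iter_mul_bounds f m.+1 n.+1.
  have /andP[_ B] := iter_mul_bounds f n.+1 m.+1.
  rewrite mulrC (mulrC _ n.+1%:R).
  by apply: le_trans A _; rewrite mulnC.
have sup_lo : has_sup (range lo).
  by split; [exists (lo 0), 0 | exists (hi 0) => _ [n _ <-]; exact: lohi].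
exists (sup (range lo)) => -[|n].
  by rewrite mul0r subr0 normr0.
have A : lo n <= sup (range lo) by apply: (ub_le_sup sup_lo.2); exists n.
have B : sup (range lo) <= hi n.
  by apply: ge_sup sup_lo.1 _ => _ [m _ <-]; exact: lohi.
move: A B; rewrite /lo /hi ler_pdivrMr ?ltr0n // ler_pdivlMr ?ltr0n //.
by rewrite ler_norml (mulrC (sup _)) => ? ?; apply/andP; split; lra.
Qed.

Lemma rot_bound f n : `|(f ^+ n)%g 0 - n%:R * rot f| <= 1.
Proof.
have [c fc] := rot_exists f; suff -> : rot f = c by [].
apply/cvg_lim => //; apply/cvgrPdist_le => e e0.
near=> k; rewrite distrC -homeo_iter.
have n0 : 0 < k%:R :> R by rewrite ltr0n; near: k; exact: nbhs_infty_gt.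
have -> : (f ^+ k)%g 0 / k%:R - c = ((f ^+ k)%g 0 - k%:R * c) / k%:R.
  by field; rewrite gt_eqF.
rewrite normrM normfV (gtr0_norm n0) ler_pdivrMr //.
apply: le_trans (fc k) _; rewrite mulrC -ler_pdivrMr // mul1r ltW //.
by near: k; exact: nbhs_infty_gtr.
Unshelve. all: by end_near. Qed.

Lemma le0_of_bounded_multiples c C : (forall n : nat, n%:R * c <= C) -> c <= 0.
Proof.
move=> cC; rewrite leNgt; apply/negP => c0.
have := cC (Num.truncn (C / c)).+1; rewrite leNgt => /negP; apply.
by rewrite -ltr_pdivrMr // truncnS_gt.
Qed.

(** All orbits stay within bounded distance of each other, and bounded errors
    vanish in the quotient by [n]; so the growth of any one orbit decides. *)
Lemma rot_le f x c C : (forall n : nat, (f ^+ n)%g x <= n%:R * c + C) -> rot f <= c.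
Proof.
move=> fc; rewrite -subr_le0.
apply: (@le0_of_bounded_multiples _ (C - x + 2)) => n.
have := fc n; have := displacement_le (f ^+ n)%g 0 x; have := rot_bound f n.
by rewrite ler_norml => /andP[]; lra.
Qed.

Lemma rot_ge f x c C : (forall n : nat, n%:R * c - C <= (f ^+ n)%g x) -> c <= rot f.
Proof.
move=> fc; rewrite -subr_le0.
apply: (@le0_of_bounded_multiples _ (C + x + 2)) => n.
have := fc n; have := displacement_le (f ^+ n)%g x 0; have := rot_bound f n.
by rewrite ler_norml => /andP[]; lra.
Qed.

Lemma rot_eq f x c C :
  (forall n : nat, `|(f ^+ n)%g x - n%:R * c| <= C) -> rot f = c.
Proof.
move=> fc; apply/eqP; rewrite eq_le; apply/andP; split.
  by apply: (@rot_le f x c C) => n; have := fc n; rewrite ler_norml; lra.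
by apply: (@rot_ge f x c C) => n; have := fc n; rewrite ler_norml; lra.
Qed.

Lemma rotX f n : rot (f ^+ n)%g = n%:R * rot f.
Proof.
apply: (@rot_eq _ 0 _ 1) => m.
by rewrite -expgnA mulrA -natrM (mulnC m); exact: rot_bound.
Qed.

(** Conjugate elements have equal rotation numbers: [(f g)^n f = f (g f)^n], and
    [f] moves all points by a bounded amount. *)
Lemma rotMC f g : rot (f * g)%g = rot (g * f)%g.
Proof.
have fgf n : ((f * g) ^+ n * f = f * (g * f) ^+ n)%g.
  elim: n => [|n IHn]; first by rewrite !expg0 mul1g mulg1.
  by rewrite !expgSr !mulgA -IHn.
apply: (@rot_eq _ (f 0) _ (`|f 0| + 2)) => n.
have -> : ((f * g) ^+ n)%g (f 0) = f (((g * f) ^+ n)%g 0).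
  by rewrite -!homeoM_app fgf.
have := rot_bound (g * f)%g n; have := ler_norm (f 0); have := ler_norm (- f 0).
set z := ((g * f) ^+ n)%g 0.
have := displacement_le f z 0; have := displacement_le f 0 z.
rewrite normrN !ler_norml => A B D E /andP[F G]; apply/andP; split; lra.
Qed.

Lemma rot_conj f g : rot (f^-1 * (g * f))%g = rot g.
Proof. by rewrite rotMC -mulgA mulgV mulg1. Qed.

Lemma rot_ge_of_point f x (N : int) : x + N%:~R <= f x -> N%:~R <= rot f.
Proof.
move=> xN; apply: (@rot_ge f x _ (- x)) => n; rewrite opprK addrC.
elim: n => [|n IHn]; first by rewrite mul0r addr0.
rewrite expgSr homeoM_app; apply: (@le_trans _ _ ((f ^+ n)%g (x + N%:~R))).
  by rewrite homeo_intD -natr1; lra.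
by rewrite homeo_le.
Qed.

Lemma rot_lt1_lt f x : rot f < 1 -> f x < x + 1.
Proof. by rewrite !ltNge; apply: contraNN => /(@rot_ge_of_point f x 1). Qed.

(** The displacement is continuous and periodic, so it has a least and a greatest
    value; the rotation number lies between them, hence is itself a value. *)
Lemma rot_int_point f (N : int) : rot f = N%:~R -> exists x, f x = x + N%:~R.
Proof.
move=> fN; pose d x := f x - x.
have dc : continuous d.
  by move=> x; apply: cvgB; [exact: hfun_continuous | exact: cvg_id].
have dp x : exists2 y, y \in `[(0:R), 1] & d y = d x.
  exists (x - (Num.floor x)%:~R).
    rewrite in_itv /=; have := Num.Theory.floor_le x.
    by have := Num.Theory.floorD1_gt x; rewrite intrD1; lra.
  by rewrite /d -mulrNz homeo_intD; lra.
have wd : {within `[(0:R), 1]%classic, continuous d}.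
  exact: continuous_subspaceT.
have [m m01 md] := EVT_min (@ler01 R) wd.
have [M M01 Md] := EVT_max (@ler01 R) wd.
have lo : d m <= N%:~R.
  rewrite -fN; apply: (@rot_ge f 0 _ 0) => n.
  have := @iter_ge_add f 1 n 0 (d m); rewrite muln1 add0r subr0; apply => y.
  by have [y' y'01 dy] := dp y; have := md _ y'01; rewrite dy /d expg1; lra.
have hi : N%:~R <= d M.
  rewrite -fN; apply: (@rot_le f 0 _ 0) => n.
  have := @iter_le_add f 1 n 0 (d M); rewrite muln1 add0r addr0; apply => y.
  by have [y' y'01 dy] := dp y; have := Md _ y'01; rewrite dy /d expg1; lra.
have [x dx] : exists x, d x = N%:~R.
  have [mM|/ltW Mm] := leP m M.
    have [| |x _ <-] := @IVT R d m M (N%:~R) mM; last by exists x.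
      exact: continuous_subspaceT.
    by rewrite ge_min le_max lo hi orbT.
  have [| |x _ <-] := @IVT R d M m (N%:~R) Mm; last by exists x.
    exact: continuous_subspaceT.
  by rewrite ge_min le_max lo hi orbT.
by exists x; rewrite -dx /d; lra.
Qed.

End RotationNumber.

(** * Positive words as sequences of blocks *)

Section Words.
Local Open Scope group_scope.

(** The product of the blocks [a b^(beta k)], the block of index 0 acting first;
    read as a map it follows an orbit block by block. *)
Fixpoint steps (G : monoidType) (a b : G) (beta : nat -> nat) (K : nat) : G :=
  if K is K'.+1 then a * b ^+ beta K' * steps a b beta K' else 1.

Lemma eq_steps (G : monoidType) (a b : G) beta beta' K :
  (forall k, (k < K)%N -> beta k = beta' k) ->
  steps a b beta K = steps a b beta' K.
Proof.
elim: K => //= K IHK eqb; rewrite eqb // IHK // => k kK.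
exact: eqb (ltnW kK).
Qed.

Lemma stepsD (G : monoidType) (a b : G) beta m n :
  steps a b beta (m + n) =
  steps a b (fun k => beta (k + n)%N) m * steps a b beta n.
Proof. by elim: m => [|m /= ->]; rewrite ?mul1g // !mulgA. Qed.

Lemma steps_periodic (G : monoidType) (a b : G) beta h n :
  (forall k, beta (k + h)%N = beta k) ->
  steps a b beta (n * h) = steps a b beta h ^+ n.
Proof.
move=> per; elim: n => [|n IHn] //.
rewrite mulSn addnC stepsD expgSr; congr (_ * _).
by rewrite -IHn; apply: eq_steps => k _; exact: per.
Qed.

Definition eval_word (G : monoidType) (a b : G) (ws : seq bool) : G :=
  foldr (fun x g => (if x then b else a) * g) 1 ws.

Lemma eval_word_cat (G : monoidType) (a b : G) s t :
  eval_word a b (s ++ t) = eval_word a b s * eval_word a b t.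
Proof. by elim: s => [|x s /= ->]; rewrite ?mul1g ?mulgA. Qed.

(** The [b]'s in front of the first [a] are left over when the letters are grouped
    from the right into blocks [a b^k]. *)
Lemma eval_word_steps (ws : seq bool) : exists (m : nat) (beta : nat -> nat),
  count_mem true ws = (m + \sum_(k < count_mem false ws) beta k)%N /\
  forall (G : monoidType) (a b : G),
    eval_word a b ws = b ^+ m * steps a b beta (count_mem false ws).
Proof.
elim: ws => [|[] ws [m [beta [cnt ev]]]] /=.
- exists 0%N, (fun=> 0%N); split; first by rewrite big_ord0.
  by move=> G a b; rewrite mul1g.
- exists m.+1, beta; rewrite !add0n cnt; split=> [|G a b]; first by rewrite add1n addSn.
  by rewrite ev mulgA -expgS.
- pose h := count_mem false ws.
  exists 0%N, (fun k => if k == h then m else beta k).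
  rewrite !add0n add1n big_ord_recr /= -/h eqxx cnt; split.
    rewrite addnC; congr addn; apply: eq_bigr => k _.
    by rewrite ltn_eqF.
  move=> G a b; rewrite ev -/h mul1g mulgA; congr (_ * _).
  by apply: eq_steps => k kh; rewrite ltn_eqF.
Qed.

Definition letters (ws : seq bool) : seq letter := [seq (x, false) | x <- ws].

Lemma foldr_push_letters ws ws' :
  foldr push (letters ws') (letters ws) = letters (ws ++ ws').
Proof.
elim: ws => [|x ws IHws] //=; rewrite IHws.
by case: ws {IHws} => [|y ws] /=; case: ws' => [|z ws'] //=;
  rewrite /linv /= xpair_eqE andbF.
Qed.

Lemma positive_eval_word (w : freeF) : positive w ->
  exists ws : seq bool, word_of w = letters ws /\
    forall (G : groupType) (rho : {multiplicative freeF -> G}),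
      rho w = eval_word (rho gen_a) (rho gen_b) ws.
Proof.
elim=> [||u v _ [us [uE rhou]] _ [vs [vE rhov]]].
- by exists [:: false]; split=> // G rho; rewrite /= mulg1.
- by exists [:: true]; split=> // G rho; rewrite /= mulg1.
exists (us ++ vs); split; first by rewrite /= uE vE foldr_push_letters.
by move=> G rho; rewrite gmulfM rhou rhov eval_word_cat.
Qed.

Lemma count_letters ws x : count_mem (x, false) (letters ws) = count_mem x ws.
Proof. by rewrite count_map; apply: eq_count => y /=; rewrite xpair_eqE andbT. Qed.

Lemma pow_gen_letters x (n : nat) (g : freeF) : word_of g = letters [:: x] ->
  word_of (g ^+ n) = letters (nseq n x).
Proof.
move=> gE; elim: n => [|n IHn] //.
by rewrite expgS /= gE IHn (foldr_push_letters [:: x]).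
Qed.

Lemma letter_in_word (w g : freeF) ws x : word_of w = letters ws ->
  word_of g = letters [:: ~~ x] -> (forall n : nat, w <> g ^+ n) ->
  (0 < count_mem x ws)%N.
Proof.
move=> wE gE wg; rewrite lt0n; apply/negP => /eqP cnt0.
apply: (wg (size ws)); apply: val_inj => /=.
rewrite wE (pow_gen_letters _ gE); congr letters.
apply/all_pred1P/allP => y yws; apply/eqP.
have : y != x.
  by apply: contraTneq yws => ->; rewrite -has_pred1 has_count cnt0.
by case: x y {gE cnt0 yws} => -[].
Qed.

(** Moving the leftover [b]'s to the other end of the word is a conjugation. *)
Lemma positive_steps (R : realType) (w : freeF) : positive w ->
    (forall n : nat, w <> gen_a ^+ n) -> (forall n : nat, w <> gen_b ^+ n) ->
  exists beta : nat -> nat,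
    [/\ (0 < h_a w)%N, (0 < h_b w)%N,
        h_b w = (\sum_(k < h_a w) beta k)%N,
        forall k, beta (k + h_a w)%N = beta k &
        forall rho : {multiplicative freeF -> homeo R},
          rot (rho w) = rot (steps (rho gen_a) (rho gen_b) beta (h_a w))].
Proof.
move=> wpos wa wb; have [ws [wE rhoE]] := positive_eval_word wpos.
have a0 : (0 < count_mem false ws)%N by exact: (@letter_in_word w gen_b).
have b0 : (0 < count_mem true ws)%N by exact: (@letter_in_word w gen_a).
have [m [beta [cnt ev]]] := eval_word_steps ws.
rewrite /h_a /h_b wE !count_letters; set h := count_mem false ws in a0 cnt ev *.
(* The m letters b on the left of the word join the block that acts first. *)
pose beta' k := (beta (k %% h) + (k %% h == 0) * m)%N.
exists beta'; split=> //.
- rewrite cnt /beta'; case: h a0 {ev cnt beta'} => // h _.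
  rewrite !big_ord_recl /= modn_small //= mul1n addnC -!addnA; congr addn.
  rewrite addnC; congr addn; apply: eq_bigr => k _.
  by rewrite modn_small ?addn0 // /bump /= add1n ltnS.
- by move=> k; rewrite /beta' modnDr.
move=> rho; rewrite rhoE ev rotMC.
suff -> : steps (rho gen_a) (rho gen_b) beta h * rho gen_b ^+ m =
    steps (rho gen_a) (rho gen_b) beta' h by [].
rewrite -(prednK a0) -addn1 !stepsD /= !mulg1 /beta' mod0n eqxx mul1n.
rewrite expgnDr !mulgA; congr (_ * _ * _ * _).
by apply: eq_steps => k kh; rewrite modn_small ?addn1 ?addn0 //; lia.
Qed.

(** Evaluation of reduced words is multiplicative because [push] cancels exactly
    the pairs of letters whose values are inverse to each other. *)
Lemma free_group_universal (G : groupType) (x y : G) :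
  exists rho : {multiplicative freeF -> G}, rho gen_a = x /\ rho gen_b = y.
Proof.
pose ev (l : letter) : G :=
  let z := if l.1 then y else x in if l.2 then (z^-1)%g else z.
have evV l : ev (linv l) = ((ev l)^-1)%g.
  by case: l => c [] //; rewrite /ev /= invgK.
pose f (w : freeF) : G := foldr (fun l g => ev l * g)%g 1%g (word_of w).
have ev_push l s : foldr (fun l g => ev l * g)%g 1%g (push l s) =
    (ev l * foldr (fun l g => ev l * g)%g 1%g s)%g.
  case: s => [|l' s] //=; case: ifPn => // /eqP ->.
  by rewrite evV mulgA mulgV mul1g.
have fM : {morph f : u v / (u * v)%g}.
  move=> u v; rewrite /f /=; elim: (word_of u) => [|l s IHs] /=.
    by rewrite mul1g.
  by rewrite ev_push IHs mulgA.
pose m := isMultiplicative.Build freeF G f fM.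
pose rho : {multiplicative freeF -> G} := HB.pack f m.
by exists rho; split; rewrite /rho /= /f /= mulg1.
Qed.

End Words.

(** * Periodic sequences and residues *)

Lemma sum_periodic (beta : nat -> nat) h n : (forall k, beta (k + h)%N = beta k) ->
  (\sum_(k < n * h) beta k = n * \sum_(k < h) beta k)%N.
Proof.
move=> per; elim: n => [|n IHn]; first by rewrite !mul0n big_ord0.
rewrite !mulSn big_split_ord /= -IHn; congr addn.
by apply: eq_bigr => k _; rewrite addnC per.
Qed.

Lemma periodic_mod h (beta : nat -> nat) K :
  (forall k, beta (k + h)%N = beta k) -> beta K = beta (K %% h)%N.
Proof.
move=> per; rewrite {1}(divn_eq K h); elim: (K %/ h)%N => // n IHn.
by rewrite mulSn -addnA addnC per.
Qed.

(** Multiplication by [u] recovers the index of an orbit point from its position: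
    [a] moves the gap number by [p], and [u] is the inverse of [p]. *)
Lemma inverse_mod (q u : nat) (p : int) (K j : nat) :
  (u%:Z * p = 1 %[mod q])%Z ->
  (K%:Z * p = j%:Z %[mod q])%Z <-> K = j * u %[mod q].
Proof.
move=> up; split=> [Kp|Kju].
  have /eqP : (K%:Z = (j * u)%:Z %[mod q])%Z.
    rewrite PoszM -(modzMml j%:Z) -Kp modzMml -mulrA (mulrC p) -(modzMmr K%:Z) up.
    by rewrite modzMmr mulr1.
  by rewrite !modz_nat => /eqP[].
have Kju' : (K%:Z = (j * u)%:Z %[mod q])%Z by rewrite !modz_nat Kju.
by rewrite -modzMml Kju' modzMml PoszM -mulrA -(modzMmr j%:Z) up modzMmr mulr1.
Qed.

Lemma exists_inverse_mod (q : nat) (p : int) : (0 < q)%N -> coprime `|p|%N q ->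
  exists u : nat, (u%:Z * p = 1 %[mod q])%Z.
Proof.
move=> q0 cop; have /coprimezP[[u v] /= uv] : coprimez p q by [].
have qn0 : q%:Z != 0 by rewrite eqz_nat -lt0n.
exists `|(u %% q)%Z|%N; rewrite gez0_abs ?modz_ge0 // modzMml -uv.
by rewrite -[in RHS]modzDmr modzMl addr0.
Qed.

(** The Chinese remainder theorem for moduli that need not be coprime. *)
Lemma chinese_gcd (q h x y : nat) : (0 < q)%N -> (0 < h)%N ->
  x = y %[mod gcdn q h] -> exists K, K = x %[mod q] /\ K = y %[mod h].
Proof.
move=> q0 h0 xy; have [km kn E _] := egcdnP q h0.
(* Adding a multiple of q to x makes the subtraction of y exact in nat. *)
have yx : (y <= x + y * q)%N by rewrite (leq_trans _ (leq_addl _ _)) // leq_pmulr.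
have /dvdnP[t xyt] : (gcdn q h %| x + y * q - y)%N.
  rewrite -eqn_mod_dvd // eq_sym -xy -modnDmr.
  by rewrite -modnMmr (eqP (dvdn_gcdl q h)) muln0 mod0n addn0.
exists (y + t * (km * h))%N; split; last by rewrite mulnA addnC modnMDl.
rewrite E gcdnC mulnDr -xyt.
have -> : (y + (t * (kn * q) + (x + y * q - y)) = x + (t * kn + y) * q)%N.
  by rewrite addnCA subnKC // addnCA mulnDl mulnA [in RHS]addnA; lia.
by rewrite addnC modnMDl.
Qed.

(** The unit [u] permutes the residues modulo [q], and each residue modulo [g] lies
    below [q / g] of them. *)
Lemma sum_residues (B : nat -> nat) (q g u : nat) (p : int) :
  (0 < q)%N -> (g %| q)%N -> (u%:Z * p = 1 %[mod q])%Z ->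
  (g * \sum_(j < q) B ((j * u) %% g) = q * \sum_(c < g) B c)%N.
Proof.
move=> q0 gq up; have g0 : (0 < g)%N by exact: dvdn_gt0 gq.
pose s (j : 'I_q) := Ordinal (ltn_pmod (j * u) q0).
have s_inj : injective s.
  move=> j j' /(congr1 val) /= jj'; apply: val_inj => /=.
  have /(inverse_mod _ _ up) E : (j * u = j * u %[mod q])%N by [].
  have := (inverse_mod (j * u)%N j' up).2 jj'; rewrite E !modz_nat !modn_small //.
  by case.
have -> : (\sum_(j < q) B ((j * u) %% g) = \sum_(j < q) B (j %% g))%N.
  rewrite [RHS](reindex s) /=; last by apply: onW_bij; exact: injF_bij.
  by apply: eq_bigr => j _; rewrite modn_dvdm.
have := @sum_periodic (fun k => B (k %% g)%N) g (q %/ g).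
rewrite divnK // => -> => [|k]; last by rewrite modnDr.
rewrite mulnA [(g * _)%N]mulnC divnK //; congr muln.
by apply: eq_bigr => c _; rewrite modn_small.
Qed.

(** The blocks met by an orbit of [w] while it visits one given gap of a periodic
    orbit of [a] are those whose index lies in a class modulo [g]. *)
Definition longest_run (h : nat) (beta : nat -> nat) (g c : nat) : nat :=
  \max_(k < h | (k %% g == c)%N) beta k.

Lemma longest_run_ge h (beta : nat -> nat) g K : (0 < h)%N -> (g %| h)%N ->
  (forall k, beta (k + h)%N = beta k) ->
  (beta K <= longest_run h beta g (K %% g))%N.
Proof.
move=> h0 gh per.
rewrite (periodic_mod K per).
apply: (@leq_bigmax_cond _ _ (fun k : 'I_h => beta k) (Ordinal (ltn_pmod K h0))).
by rewrite /= modn_dvdm.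
Qed.

(** Every class modulo [g] contains an index below [h] because [g] divides [h], so
    the maximum is not taken over the empty set. *)
Lemma longest_run_attained h beta g c : (0 < h)%N -> (g %| h)%N -> (c < g)%N ->
  exists2 k, longest_run h beta g c = beta k & k = c %[mod g].
Proof.
move=> h0 gh cg; have ch : (c < h)%N by apply: leq_trans cg (dvdn_leq h0 gh).
have [|k kc Ek] := @eq_bigmax_cond _ [pred k : 'I_h | (k %% g == c)%N] (fun k => beta k).
  by apply/card_gt0P; exists (Ordinal ch); rewrite inE /= modn_small.
exists k; first by rewrite -Ek; apply: eq_bigl => i; rewrite inE.
by move: kc; rewrite inE => /eqP ->; rewrite modn_small.
Qed.

Lemma longest_run_gt0 h (beta : nat -> nat) g : (0 < h)%N -> (g %| h)%N ->
  (0 < \sum_(k < h) beta k)%N -> (0 < \sum_(c < g) longest_run h beta g c)%N.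
Proof.
move=> h0 gh; rewrite lt0n sum_nat_eq0 negb_forall => /existsP[k bk].
have g0 : (0 < g)%N by exact: dvdn_gt0 gh.
rewrite (bigD1 (Ordinal (ltn_pmod k g0))) //= ltn_addr //.
apply: (@leq_trans (beta k)); first by rewrite lt0n.
exact: (@leq_bigmax_cond _ (fun i : 'I_h => (i %% g == k %% g)%N)
  (fun i : 'I_h => beta i)).
Qed.

(** * The bounds satisfied by every representation *)

Section UpperBound.
Variable R : realType.
Implicit Types (a b : homeo R) (beta : nat -> nat).

Lemma iter_le_nat b n x : (forall y, b y <= y + 1) -> (b ^+ n)%g x <= x + n%:R.
Proof.
by move=> b1; have := @iter_le_add R b 1 n x 1; rewrite muln1 mulr1; apply.
Qed.

Lemma steps_le a b beta K x : (forall y, b y <= y + 1) ->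
  steps a b beta K x <= (a ^+ K)%g x + (\sum_(k < K) beta k)%:R.
Proof.
move=> b1; elim: K => [|K IHK]; first by rewrite big_ord0 addr0.
rewrite big_ord_recr /= expgS !homeoM_app natrD addrA -!homeo_natD homeo_le.
apply: le_trans (iter_le_nat _ _ b1) _.
by rewrite !homeo_natD; have := IHK; lra.
Qed.

(** A map [b] with [rot b < 1] moves every point by less than 1, so the word is
    dominated by the one in which [b] is the translation by 1. *)
Lemma rot_steps_le a b beta h : (forall k, beta (k + h)%N = beta k) ->
  rot b < 1 ->
  rot (steps a b beta h) <= h%:R * rot a + (\sum_(k < h) beta k)%:R.
Proof.
move=> per b1; apply: (@rot_le R _ 0 _ 1) => n.
rewrite -steps_periodic //.
apply: le_trans (steps_le _ _ _ _ _) _ => [y|].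
  exact/ltW/rot_lt1_lt.
rewrite sum_periodic // natrM; have := rot_bound a (n * h).
by rewrite ler_norml natrM; lra.
Qed.

(** The staircase attached to a point [x0] with [a^q x0 = x0 + p].  From a
    fixed origin it counts the lifts below [x] of the [q] points of the periodic
    orbit on the circle; thus it numbers the gaps of that orbit in their order
    on the line. *)
Definition level a (q : nat) (x0 x : R) : int :=
  \sum_(j < q) Num.floor ((a ^+ j)%g x - x0).

Lemma le_level a q x0 x y : x <= y -> level a q x0 x <= level a q x0 y.
Proof.
move=> xy; apply: ler_sum => j _; rewrite Num.Theory.floor_ge_int.
apply: le_trans (Num.Theory.floor_le _) _; by rewrite lerD2r homeo_le.
Qed.

Lemma levelD a (q : nat) x0 x (n : int) :
  level a q x0 (x + n%:~R) = level a q x0 x + n * q.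
Proof.
rewrite /level.
transitivity (\sum_(j < q) (Num.floor ((a ^+ j)%g x - x0) + n)).
  apply: eq_bigr => j _; rewrite homeo_intD addrAC.
  by rewrite Num.Theory.floorDrz ?intr_int // Num.Theory.intrKfloor.
by rewrite big_split /= sumr_const card_ord -mulr_natr natz.
Qed.

(** Applying [a] shifts the sum defining the level by one index; the term that
    enters exceeds the one that leaves by [p]. *)
Lemma level_app a (q : nat) (p : int) x0 x :
  (a ^+ q)%g x0 = x0 + p%:~R -> level a q x0 (a x) = level a q x0 x + p.
Proof.
move=> ax0.
have fl : Num.floor ((a ^+ q)%g x - x0) = Num.floor (x - x0) + p.
  apply/Num.Theory.floor_def; set n := Num.floor (x - x0).
  have n1 : x0 + n%:~R <= x by have := Num.Theory.floor_le (x - x0); rewrite -/n; lra.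
  have n2 : x < x0 + (n + 1)%:~R.
    by have := Num.Theory.floorD1_gt (x - x0); rewrite -/n; lra.
  have {}n1 : (a ^+ q)%g (x0 + n%:~R) <= (a ^+ q)%g x by rewrite homeo_le.
  have {}n2 : (a ^+ q)%g x < (a ^+ q)%g (x0 + (n + 1)%:~R) by exact: hfun_incr.
  by move: n1 n2; rewrite !homeo_intD ax0 !intrD; lra.
rewrite /level; apply: (addrI (Num.floor (x - x0))).
transitivity (\sum_(j < q.+1) Num.floor ((a ^+ j)%g x - x0)).
  rewrite big_ord_recl; congr (_ + _); apply: eq_bigr => j _.
  by rewrite lift0 expgSr.
by rewrite big_ord_recr /= fl addrCA addrA.
Qed.

(** Equality in the upper bound forces an orbit along which no level is lost.  This
    yields in each gap [j] a point that [M j] iterates of [b - 1] keep in the gap;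
    by monotonicity any point above the gap stays in it or above it under these
    iterates, and a full turn of gaps takes [V] iterates. *)
Lemma rot_ge_of_maximum (a b : homeo R) (beta : nat -> nat) (h q u : nat) (p : int)
    (M : nat -> nat) :
  (0 < h)%N -> (0 < q)%N -> (u%:Z * p = 1 %[mod q])%Z ->
  (forall k, beta (k + h)%N = beta k) ->
  (forall j, exists2 K, M j = beta K & K = j * u %[mod q]) ->
  q%:R * rot a = p%:~R -> rot b < 1 ->
  rot (steps a b beta h) = h%:R * rot a + (\sum_(k < h) beta k)%:R ->
  (\sum_(j < q) M j)%:R - 1 <= (\sum_(j < q) M j)%:R * rot b.
Proof.
move=> h0 q0 up per MP ra rb rw.
have b1 y : b y <= y + 1 by exact/ltW/rot_lt1_lt.
have [x0 ax0] : exists x, (a ^+ q)%g x = x + p%:~R.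
  by apply: rot_int_point; rewrite rotX.
pose phi := level a q x0.
have phiD (x : R) n : phi (x + n%:~R) = phi x + n * q by exact: levelD.
have phi_natD x (n : nat) : phi (x + n%:R) = phi x + n%:Z * q.
  by rewrite -phiD pmulrn.
have phi_le x y : x <= y -> phi x <= phi y by exact: le_level.
have phia x : phi (a x) = phi x + p by exact: level_app.
pose S K := (\sum_(k < K) beta k)%N.
have [z wz] : exists z, (steps a b beta h ^+ q)%g z
    = z + (h%:Z * p + q%:Z * (S h)%:Z)%:~R.
  apply: rot_int_point; rewrite rotX rw mulrDr mulrCA ra.
  by rewrite intrD !intrM -!pmulrn.
pose Z K := steps a b beta K z.
(* The loss can only grow with K, and it vanishes after every period of the orbit
   of z; so it is always 0. *)
pose loss K := phi z + K%:Z * p + q%:Z * (S K)%:Z - phi (Z K).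
have phib n y : phi ((b ^+ n)%g y) <= phi y + n%:Z * q.
  by rewrite -phi_natD; apply/phi_le/iter_le_nat.
have ZS K : Z K.+1 = a ((b ^+ beta K)%g (Z K)) by [].
have SS K : S K.+1 = (S K + beta K)%N by rewrite /S big_ord_recr.
have loss_le K : loss K <= loss K.+1.
  rewrite /loss ZS SS phia; have := phib (beta K) (Z K).
  by lia.
have loss_per n : loss (n * (q * h))%N = 0.
  have ZE : Z (n * (q * h))%N = z + (n%:Z * (h%:Z * p + q%:Z * (S h)%:Z))%:~R.
    by rewrite /Z mulnA steps_periodic // (mulnC n) expgnA; exact: iter_intD.
  rewrite /loss ZE phiD /S mulnA sum_periodic //; rewrite -/(S h); lia.
have loss_mono m n : (m <= n)%N -> loss m <= loss n.
  by move=> /subnK <-; elim: (n - m)%N => // k IHk; exact: le_trans IHk _.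
have loss0 K : loss K = 0.
  apply/eqP; rewrite eq_le; apply/andP; split.
    by rewrite -(loss_per K); apply: loss_mono; rewrite leq_pmulr // muln_gt0 q0.
  by rewrite -(loss_per 0%N); apply: loss_mono.
have phiZ K : phi (Z K) = phi z + K%:Z * p + q%:Z * (S K)%:Z.
  by have := loss0 K; rewrite /loss; lia.
have phibZ K : phi ((b ^+ beta K)%g (Z K)) = phi (Z K) + q%:Z * (beta K)%:Z.
  by have := phiZ K.+1; rewrite ZS phia SS phiZ; lia.
have gap j y : phi z + j.+1%:Z <= phi y ->
    phi z + j%:Z + q%:Z * (M j)%:Z <= phi ((b ^+ M j)%g y).
  have [K -> Kju] := MP j => jy.
  have [l Kp] : exists l, K%:Z * p = j%:Z + q%:Z * l.
    have /eqP : (K%:Z = (j * u)%:Z %[mod q])%Z by rewrite !modz_nat Kju.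
    rewrite eqz_mod_dvd => /dvdzP[l1 Kl].
    move/eqP: up; rewrite eqz_mod_dvd => /dvdzP[l2 ul].
    exists (l1 * p + j%:Z * l2).
    have -> : K%:Z * p = (K%:Z - (j * u)%:Z) * p + j%:Z * (u%:Z * p - 1) + j%:Z.
      by rewrite PoszM; ring.
    by rewrite Kl ul; ring.
  (* The integer translation that brings the orbit point into the gap j. *)
  pose n : int := (S K)%:Z + l.
  have zetay : Z K - n%:~R <= y.
    rewrite leNgt; apply/negP => /ltW /phi_le; rewrite -mulrNz phiD phiZ Kp /n.
    by move: jy; lia.
  have : phi ((b ^+ beta K)%g (Z K - n%:~R)) <= phi ((b ^+ beta K)%g y).
    by apply: phi_le; rewrite homeo_le.
  apply: le_trans.
  rewrite -mulrNz homeo_intD phiD phibZ phiZ Kp /n; lia.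
pose SM n := (\sum_(j < n) M j)%N.
have gaps n y : phi z + n%:Z <= phi y ->
    phi z + q%:Z * (SM n)%:Z <= phi ((b ^+ SM n)%g y).
  elim: n y => [|n IHn] y ny; first by rewrite /SM big_ord0 expg0 homeo1_app; lia.
  have -> : SM n.+1 = (SM n + M n)%N by rewrite /SM big_ord_recr.
  have -> : (b ^+ (SM n + M n))%g y = (b ^+ SM n)%g ((b ^+ M n)%g y).
    by rewrite expgnDr.
  set y' := (b ^+ M n)%g y.
  have y'n : phi z + n%:Z <= phi (y' - (M n)%:~R).
    by rewrite -mulrNz phiD; have := gap n y ny; rewrite -/y'; lia.
  have := IHn _ y'n; rewrite -mulrNz homeo_intD phiD; lia.
rewrite -/(SM q); set V := SM q.
have orbit n : phi z + q%:Z + n%:Z * (V%:Z - 1) * q%:Z <=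
    phi (((b ^+ V) ^+ n)%g (z + 1)).
  elim: n => [|n IHn].
    by rewrite homeo1_app (phi_natD z 1%N); lia.
  rewrite expgS homeoM_app; set y := ((b ^+ V) ^+ n)%g (z + 1).
  have yn : phi z + q%:Z <= phi (y - (n%:Z * (V%:Z - 1))%:~R).
    by rewrite -mulrNz phiD; move: IHn; rewrite -/y; lia.
  have := gaps q _ yn; rewrite -mulrNz homeo_intD phiD -/V.
  by lia.
rewrite -rotX; apply: (@rot_ge R _ (z + 1) _ (- z)) => n.
rewrite leNgt; apply/negP => /ltW lt_orbit.
have /phi_le : ((b ^+ V) ^+ n)%g (z + 1) <= z + (n%:Z * (V%:Z - 1))%:~R.
  by apply: le_trans lt_orbit _; rewrite intrM intrB -!pmulrn; lra.
by rewrite phiD; have := orbit n; lia.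
Qed.

End UpperBound.

(** * Representations reaching the maximum *)

Section Constructions.
Variable R : realType.
Implicit Types (x y c d t : R).

(** The preimages of [f x - e] and [f x + e] bound a neighbourhood of [x]. *)
Lemma increasing_cancel_continuous (f g : R -> R) :
  cancel f g -> cancel g f -> {homo f : x y / x < y} -> continuous f.
Proof.
move=> fK gK fi x; have fm := leW_mono (le_mono fi).
apply/cvgrPdist_lt => e e0.
have gx : g (f x - e) < x < g (f x + e).
  by rewrite -[_ < x]fm -[x < _]fm !gK; apply/andP; split; lra.
have : \forall y \near x, y \in `]g (f x - e), g (f x + e)[.
  by apply: near_in_itvoo; rewrite in_itv.
apply: filterS => y; rewrite in_itv /= -[_ < y]fm -[y < _]fm !gK => /andP[? ?].
by rewrite ltr_norml; apply/andP; split; lra.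
Qed.

Lemma homeo_of_cancel (f g : R -> R) :
    cancel f g -> cancel g f -> {homo f : x y / x < y} ->
    (forall x, f (x + 1) = f x + 1) ->
  exists h : homeo R, forall x, h x = f x.
Proof.
move=> fK gK fi f1; have fm := leW_mono (le_mono fi).
have gi : {homo g : x y / x < y} by move=> x y; rewrite -(fm (g x)) !gK.
by exists (@Homeo R f g fK gK (increasing_cancel_continuous fK gK fi)
             (increasing_cancel_continuous gK fK gi) fi f1).
Qed.

Lemma homeo_of_increasing (f : R -> R) :
    continuous f -> {homo f : x y / x < y} -> (forall x, f (x + 1) = f x + 1) ->
  exists h : homeo R, forall x, h x = f x.
Proof.
move=> fc fi f1; have fle := le_mono fi.
have fD n x : f (x + n%:R) = f x + n%:R.
  by elim: n => [|n IHn]; rewrite ?addr0 // -natr1 !addrA f1 IHn.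
have surj y : exists x, f x = y.
  pose n := (Num.truncn `|y - f 0|).+1.
  have : `|y - f 0| < n%:R by exact: truncnS_gt.
  rewrite ltr_norml => /andP[lo hi].
  have fn : f (- n%:R) = f 0 - n%:R.
    by apply/eqP; rewrite eq_sym subr_eq -fD addNr.
  have fp : f n%:R = f 0 + n%:R by rewrite -fD add0r.
  have n0 : - n%:R <= n%:R :> R by have := ler0n R n; lra.
  have [| |x _ fx] := @IVT R f _ _ y n0; last by exists x.
    exact: continuous_subspaceT.
  by rewrite fn fp ge_min le_max; apply/andP; split; apply/orP;
    [left|right]; lra.
have [g gK] := choice surj.
apply: (@homeo_of_cancel f g) => // x.
by apply: (inc_inj fle); rewrite gK.
Qed.

Lemma translation_exists t : exists h : homeo R, forall x, h x = x + t.
Proof.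
apply: (@homeo_of_cancel _ (fun x => x - t)) => [x|x|x y xy|x]; lra.
Qed.

Lemma affine_conj_exists (h : homeo R) (q : nat) (r c : R) : (0 < q)%N ->
  exists f : homeo R, forall x, f x = (h (q%:R * x - c) + r) / q%:R.
Proof.
move=> q0; have q0' : 0 < q%:R :> R by rewrite ltr0n.
have qn0 : q%:R != 0 :> R by rewrite gt_eqF.
have qK y : q%:R * (y / q%:R) = y by field.
apply: (@homeo_of_cancel _ (fun x => (hinv h (q%:R * x - r) + c) / q%:R)) => [x|x|x y xy|x].
- by rewrite qK addrK hfunK subrK mulrAC divff // mul1r.
- by rewrite qK addrK hinvK subrK mulrAC divff // mul1r.
- rewrite ltr_pM2r ?invr_gt0 // ltrD2r; apply: hfun_incr.
  by rewrite ltrD2r ltr_pM2l.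
- by rewrite mulrDr mulr1 addrAC homeo_natD; field.
Qed.

(** The projective map of the unit interval that fixes its ends and has
    derivative [k] at 0; a single formula without case distinction, with inverse
    given by [k^-1], moves any interior point to any other. *)
Definition mobius (k s : R) : R := k * s / (1 + (k - 1) * s).

Lemma mobius_den (k s : R) : 0 < k -> 0 <= s < 1 -> 0 < 1 + (k - 1) * s.
Proof. by move=> k0 /andP[s0 s1]; have := mulr_ge0 (ltW k0) s0; nra. Qed.

Lemma mobius_itv (k s : R) : 0 < k -> 0 <= s < 1 -> 0 <= mobius k s < 1.
Proof.
move=> k0 s01; have D := mobius_den k0 s01; case/andP: s01 => s0 s1.
rewrite /mobius; apply/andP; split; last by rewrite ltr_pdivrMr //; nra.
by apply: divr_ge0; [apply: mulr_ge0 => //|]; exact: ltW.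
Qed.

Lemma mobiusK (k s : R) : 0 < k -> 0 <= s < 1 -> mobius k^-1 (mobius k s) = s.
Proof.
move=> k0 s01; have D := mobius_den k0 s01.
have k1 : 0 < k^-1 by rewrite invr_gt0.
have := mobius_den k1 (mobius_itv k0 s01); rewrite /mobius => D'.
field; rewrite !gt_eqF //=; lra.
Qed.

Lemma mobius_incr (k s s' : R) : 0 < k -> 0 <= s < 1 -> 0 <= s' < 1 -> s < s' ->
  mobius k s < mobius k s'.
Proof.
move=> k0 s01 s01' ss'; have D := mobius_den k0 s01.
have D' := mobius_den k0 s01'; rewrite /mobius ltr_pdivrMr // mulrAC.
rewrite ltr_pdivlMr //; nra.
Qed.

Lemma push_exists c d : 0 < c < 1 -> 0 < d < 1 ->
  exists h : homeo R, h 0 = 0 /\ h c = d.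
Proof.
move=> /andP[c0 c1] /andP[d0 d1].
pose F k x := (Num.floor x)%:~R + mobius k (x - (Num.floor x)%:~R).
have fr x : 0 <= x - (Num.floor x)%:~R < 1.
  have := Num.Theory.floor_le x; have := Num.Theory.floorD1_gt x.
  by rewrite intrD => ? ?; apply/andP; split; lra.
have flF k x : 0 < k -> Num.floor (F k x) = Num.floor x.
  move=> k0; apply/Num.Theory.floor_def; rewrite intrD /F.
  by have /andP[? ?] := mobius_itv k0 (fr x); apply/andP; split; lra.
have FK k x : 0 < k -> F k^-1 (F k x) = x.
  move=> k0; rewrite /F -/(F k x) flF //.
  have -> : F k x - (Num.floor x)%:~R = mobius k (x - (Num.floor x)%:~R).
    by rewrite /F addrAC subrr add0r.
  by rewrite mobiusK // addrCA subrr addr0.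
(* The derivative at 0 for which the projective map sends c to d. *)
pose k := d * (1 - c) / (c * (1 - d)).
have k0 : 0 < k by rewrite divr_gt0 // mulr_gt0 // subr_gt0.
have [|x|x y xy|x|h hF] := @homeo_of_cancel (F k) (F k^-1).
- by move=> x; exact: FK.
- by have := @FK k^-1 x; rewrite invrK; apply; rewrite invr_gt0.
- have [fxy|fxy] := eqVneq (Num.floor x) (Num.floor y).
    rewrite /F -fxy ltrD2l; apply: mobius_incr => //; last by rewrite ltrD2r.
    by rewrite fxy.
  have fl : Num.floor x + 1 <= Num.floor y.
    rewrite lezD1 lt_neqAle fxy Num.Theory.floor_ge_int.
    by apply: le_trans (Num.Theory.floor_le x) (ltW xy).
  have : (Num.floor x)%:~R + 1 <= (Num.floor y)%:~R :> R by rewrite -intrD1 ler_int.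
  have /andP[? ?] := mobius_itv k0 (fr x); have /andP[? ?] := mobius_itv k0 (fr y).
  by rewrite /F; lra.
- rewrite /F Num.Theory.floorDrz ?int_num1 // Num.Theory.floor1 intrD.
  have -> : x + 1 - ((Num.floor x)%:~R + 1%:~R) = x - (Num.floor x)%:~R by ring.
  by rewrite addrAC.
exists h; rewrite !hF /F /mobius; split.
  by rewrite Num.Theory.floor0 subrr mulr0 mul0r addr0.
have -> : Num.floor c = 0 by apply: Num.Theory.floor_def; rewrite add0r c1 ltW.
by rewrite /k; field; apply/and3P; split; apply: lt0r_neq0; lra.
Qed.

Lemma weighted_sum_exists (L : homeo R) (q : nat) (M : nat -> nat) (s : nat -> R) :
    (0 < \sum_(i < q) M i)%N ->
  exists H : homeo R, forall x,
    H x = (\sum_(i < q) (M i)%:R * L (x - s i)) / (\sum_(i < q) M i)%:R.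
Proof.
set V := (\sum_(i < q) M i)%N => V0; have V0' : 0 < V%:R :> R by rewrite ltr0n.
apply: homeo_of_increasing => [|x y xy|x].
- move=> x; apply: cvgM; last exact: cvg_cst.
  apply: cvg_big => [|i _]; first exact: add_continuous.
  apply: cvgM; first exact: cvg_cst.
  apply: (@continuous_comp _ _ _ (fun x => x - s i) L); last exact: hfun_continuous.
  by apply: cvgB; [exact: cvg_id | exact: cvg_cst].
- rewrite ltr_pM2r ?invr_gt0 //.
  have [i _ Mi] : exists2 i : 'I_q, true & (0 < M i)%N.
    move: V0; rewrite lt0n /V sum_nat_eq0 negb_forall => /existsP[i].
    by rewrite /= -lt0n; exists i.
  rewrite (bigD1 i) //= [ltRHS](bigD1 i) //=; apply: ltr_leD.
    by rewrite ltr_pM2l ?ltr0n //; apply: hfun_incr; rewrite ltrD2r.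
  apply: ler_sum => k _; apply: ler_wpM2l => //.
  by rewrite homeo_le lerD2r ltW.
- rewrite -[X in _ = _ + X](@divff _ V%:R) ?gt_eqF // -mulrDl; congr (_ / _).
  rewrite /V natr_sum -big_split; apply: eq_bigr => i _ /=.
  by rewrite addrAC hfunD1 mulrDr mulr1.
Qed.

(** The hypothesis says that [f] acts on the translates of [x] by multiples of
    [1/q] as the translation by [p/q]. *)
Lemma rot_rational (f : homeo R) x (q : nat) (p : int) : (0 < q)%N ->
  (forall k : int, f (x + k%:~R / q%:R) = x + (k + p)%:~R / q%:R) ->
  rot f = p%:~R / q%:R.
Proof.
move=> q0 fx; apply: (@rot_eq _ _ x _ `|x|) => n.
have -> : (f ^+ n)%g x = x + (n%:Z * p)%:~R / q%:R; last first.
  by rewrite intrM -pmulrn -mulrA addrK.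
elim: n => [|n IHn]; first by rewrite !mul0r addr0.
by rewrite expgS homeoM_app IHn fx intS mulrDl mul1r (addrC p).
Qed.

(** The push of [1/4] to [3/4] in the unit interval, copied into each gap
    [ [i/q, (i+1)/q] ] and followed by the translation by [p/q]; the ends of the
    gaps still rotate rigidly. *)
Lemma gap_push_exists (q : nat) (p : int) : (0 < q)%N ->
  exists a : homeo R, rot a = p%:~R / q%:R /\
    forall i : int, a ((i%:~R + 4^-1) / q%:R) = ((i + p)%:~R + 3 / 4) / q%:R.
Proof.
move=> q0; have qn0 : q%:R != 0 :> R by rewrite pnatr_eq0 -lt0n.
have qK y : q%:R * (y / q%:R) = y by rewrite mulrC divfK.
have [||h [h0 h1]] := @push_exists 4^-1 (3 / 4); try by lra.
have [a aE] := affine_conj_exists h p%:~R 0 q0; exists a; split=> [|i].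
  apply: (@rot_rational _ 0) => // k.
  have hk : h k%:~R = k%:~R by rewrite -[k%:~R]add0r homeo_intD h0.
  by rewrite !add0r aE subr0 qK hk intrD.
rewrite aE subr0 qK (addrC i%:~R) homeo_intD h1 intrD; congr (_ / _); lra.
Qed.

(** For [t > 1 - 1/v] a translation has room to spare.  At [t = 1 - 1/v] the
    translation sends each point of the lattice to the preceding one, plus 1, and
    the needed gain is produced by pushing points away from a periodic orbit
    halfway between the lattice points. *)
Lemma lattice_push_exists (v : nat) t : (0 < v)%N -> 1 - v%:R^-1 <= t < 1 ->
  exists (f : homeo R) d, [/\ 0 < d < 1, rot f = t &
    forall i : int, 1 + (i%:~R + d) / v%:R <= f ((i + 1)%:~R / v%:R)].
Proof.
move=> v0 /andP[vt t1]; have v0' : 0 < v%:R :> R by rewrite ltr0n.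
have vn0 : v%:R != 0 :> R by rewrite gt_eqF.
have vK y : v%:R * (y / v%:R) = y by rewrite mulrC divfK.
move: vt; rewrite le_eqVlt => /orP[/eqP tE|vt].
  have [||h [h0 h1]] := @push_exists 2^-1 (3 / 4); try by lra.
  have [f fE] := affine_conj_exists h (v%:R - 2^-1) 2^-1 v0.
  exists f, 4^-1; split; first by lra.
    have -> : t = (v%:Z - 1)%:~R / v%:R by rewrite -tE intrB -pmulrn; field.
    apply: (@rot_rational _ (2^-1 / v%:R)) => // k.
    have hk : h k%:~R = k%:~R by rewrite -[k%:~R]add0r homeo_intD h0.
    have -> : 2^-1 / v%:R + k%:~R / v%:R = (2^-1 + k%:~R) / v%:R :> R.
      by rewrite mulrDl.
    rewrite fE vK addrAC subrr add0r hk intrD intrB -pmulrn.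
    by field.
  move=> i; rewrite fE vK.
  have -> : (i + 1)%:~R - 2^-1 = 2^-1 + i%:~R :> R by rewrite intrD; lra.
  rewrite homeo_intD h1 le_eqVlt; apply/orP; left; apply/eqP; by field.
have [f fE] := translation_exists t.
have vt' : v%:R * (1 - v%:R^-1) < v%:R * t by rewrite ltr_pM2l.
have vt'' : v%:R * t < v%:R * 1 by rewrite ltr_pM2l.
rewrite mulrBr mulr1 divff // in vt'.
(* The choice of d makes the inequality an equality. *)
exists f, (1 - v%:R * (1 - t)); split.
- by apply/andP; split; lra.
- apply: (@rot_eq _ _ 0 _ 0) => n.
  suff -> : (f ^+ n)%g 0 = n%:R * t by rewrite subrr normr0.
  elim: n => [|n IHn]; first by rewrite mul0r.
  by rewrite expgS homeoM_app IHn fE -natr1 mulrDl mul1r.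
move=> i; rewrite fE intrD le_eqVlt; apply/orP; left; apply/eqP; by field.
Qed.

Lemma conj_iter (f H : homeo R) n x :
  ((H^-1 * (f * H)) ^+ n)%g x = (H^-1)%g ((f ^+ n)%g (H x)).
Proof.
have -> : ((H^-1 * (f * H)) ^+ n = H^-1 * (f ^+ n * H))%g => //.
elim: n => [|n IHn]; first by rewrite mul1g mulVg.
by rewrite !expgS IHn -!mulgA; congr (_ * (_ * _))%g; rewrite mulgA mulgV mul1g.
Qed.

(** One step moves back by one lattice point with a gain [d]; the gain of the last
    step survives, those of the others are given up to return to the lattice. *)
Lemma lattice_push_iter (f : homeo R) (v : nat) d (i : int) n : (0 < v)%N ->
    0 < d -> (forall k : int, 1 + (k%:~R + d) / v%:R <= f ((k + 1)%:~R / v%:R)) ->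
  (0 < n)%N -> n%:R + (i%:~R + d) / v%:R <= (f ^+ n)%g ((i + n%:Z)%:~R / v%:R).
Proof.
move=> v0 d0 fd; have v0' : 0 < v%:R^-1 :> R by rewrite invr_gt0 ltr0n.
case: n => // n _; elim: n => [|n IHn]; first exact: fd.
rewrite expgSr homeoM_app.
apply: (@le_trans _ _ ((f ^+ n.+1)%g ((i + n.+1%:Z)%:~R / v%:R + 1%:R))).
  by rewrite homeo_natD -[in leLHS]natr1; move: IHn; lra.
rewrite homeo_le addrC -[n.+2]addn1 PoszD addrA; apply: le_trans (fd _).
by rewrite lerD2l ler_pM2r // lerDl ltW.
Qed.

(** The homeomorphism is a conjugate of a lattice push by a degree one map [H]
    which is steep in the middle half of each gap [ [j/q, (j+1)/q] ] and almost
    constant elsewhere, so that the middle half of the [j]-th gap covers [M j]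
    consecutive points of the lattice [1/V Z]. *)
Lemma gap_return_exists (q : nat) (M : nat -> nat) t : (0 < q)%N ->
    (0 < \sum_(i < q) M i)%N -> 1 - (\sum_(i < q) M i)%:R^-1 <= t < 1 ->
  exists b : homeo R, rot b = t /\ forall j, (j < q)%N ->
    (j%:R + 4^-1) / q%:R + (M j)%:R <= (b ^+ M j)%g ((j%:R + 3 / 4) / q%:R).
Proof.
move=> q0 V0 tV; set V := (\sum_(i < q) M i)%N in V0 tV.
have q0' : 0 < q%:R :> R by rewrite ltr0n.
have V0' : 0 < V%:R :> R by rewrite ltr0n.
have qV : 0 < q%:R^-1 :> R by rewrite invr_gt0.
have [f [d [/andP[d0 d1] rf fd]]] := lattice_push_exists V0 tV.
have q1 : q%:R^-1 <= 1 :> R by rewrite invf_le1 // ler1n.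
(* L rises by at most d/V on [0, c] and makes up for it on [c, 1], an interval of
   half the length of a gap; the choice of d/V makes the V errors add up to d. *)
have [||L [L0 Lc]] := @push_exists (1 - 2^-1 / q%:R) (d / V%:R).
- by apply/andP; split; lra.
- rewrite divr_gt0 //= ltr_pdivrMr // mul1r; apply: lt_le_trans d1 _.
  by rewrite ler1n.
have L1 x : L (x - 1) = L x - 1 by have := homeo_intD L x (-1); rewrite mulrN1z.
have [H HE] := @weighted_sum_exists L q M (fun i => (i%:R + 3 / 4) / q%:R) V0.
exists (H^-1 * (f * H))%g; split; first by rewrite rot_conj.
move=> j jq; rewrite conj_iter.
have [->|Mj0] := posnP (M j).
  by rewrite addr0 expg0 homeo1_app homeoV_app ler_pM2r // lerD2l; lra.
(* Up to the factor V and the error d, the values of H at the ends of the middle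
   half of the gap j are the opposites of T + M j and of T. *)
pose T := (\sum_(i < q) M i * (j < i))%N.
have TM : (\sum_(i < q) M i * (j <= i) = T + M j)%N.
  rewrite (bigD1 (Ordinal jq)) //= leqnn muln1 addnC; congr addn.
  rewrite /T [RHS](bigD1 (Ordinal jq)) //= ltnn muln0 add0n.
  apply: eq_bigr => i ij.
  by rewrite [(j < i)%N]ltn_neqAle eq_sym -(inj_eq val_inj) /= in ij *; rewrite ij.
have He : (- T%:Z)%:~R / V%:R <= H ((j%:R + 3 / 4) / q%:R).
  rewrite HE ler_pM2r ?invr_gt0 // mulrNz -pmulrn /T natr_sum -sumrN.
  apply: ler_sum => i _; rewrite natrM -mulrN ler_wpM2l //.
  rewrite -mulrBl opprD addrACA subrr addr0.
  have [ji|ij] := ltnP j i.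
    rewrite -[leLHS]add0r -[X in X - _]L0 -L1 homeo_le add0r ler_pdivlMr //.
    have : (i%:R : R) <= q%:R by rewrite ler_nat ltnW.
    by have := ler0n R j; lra.
  rewrite oppr0 -[leLHS]L0 homeo_le divr_ge0 // ?subr_ge0 ?ler_nat //.
have Hm : H ((j%:R + 4^-1) / q%:R) <= ((- T%:Z - (M j)%:Z)%:~R + d) / V%:R.
  rewrite HE ler_pM2r ?invr_gt0 // -opprD -PoszD -TM mulrNz -pmulrn.
  have -> : d = \sum_(i < q) (M i)%:R * (d / V%:R).
    by rewrite -mulr_suml -natr_sum -/V mulrC divfK // gt_eqF.
  rewrite natr_sum -sumrN -big_split /=.
  apply: ler_sum => i _; rewrite natrM -[X in _ <= X + _]mulrN -mulrDr ler_wpM2l //.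
  rewrite -mulrBl opprD addrACA.
  have iq : (i.+1%:R : R) <= q%:R by rewrite ler_nat.
  have jq' : (j.+1%:R : R) <= q%:R by rewrite ler_nat.
  have [ji|ij] := leqP j i.
    rewrite -Lc [leRHS]addrC -L1 homeo_le.
    have ji' : (j%:R : R) <= i%:R by rewrite ler_nat.
    rewrite ler_pdivrMr // mulrBl mulrBl divfK ?gt_eqF //; lra.
  rewrite oppr0 add0r -Lc homeo_le ler_pdivrMr // mulrBl divfK ?gt_eqF //.
  by have := ler0n R i; rewrite -natr1 in jq'; lra.
rewrite -[_ / _ in leLHS](homeoV_app H) -homeo_natD homeo_le.
apply: (@le_trans _ _ ((f ^+ M j)%g ((- T%:Z - (M j)%:Z + (M j)%:Z)%:~R / V%:R))).
  by have := lattice_push_iter (- T%:Z - (M j)%:Z) V0 d0 fd Mj0; lra.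
by rewrite homeo_le subrK.
Qed.

(** With these [a] and [b], the orbit of the three quarter point of the gap 0 is,
    after each block, at or above the three quarter point of the gap that it would
    reach if [b] were the translation by 1. *)
Lemma maximum_exists (q h u : nat) (p : int) (beta M : nat -> nat) (t : R) :
  (0 < q)%N -> (u%:Z * p = 1 %[mod q])%Z ->
  (forall k, beta (k + h)%N = beta k) ->
  (forall j K, (j < q)%N -> K = j * u %[mod q] -> (beta K <= M j)%N) ->
  (0 < \sum_(j < q) M j)%N -> 1 - (\sum_(j < q) M j)%:R^-1 <= t < 1 ->
  exists a b : homeo R, [/\ rot a = p%:~R / q%:R, rot b = t &
    h%:R * (p%:~R / q%:R) + (\sum_(k < h) beta k)%:R <= rot (steps a b beta h)].
Proof.
move=> q0 up per betaM V0 tV; have q0' : 0 < q%:R :> R by rewrite ltr0n.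
have [a [ra aE]] := gap_push_exists p q0.
have [b [rb bE]] := gap_return_exists q0 V0 tV.
have b1 y : b y <= y + 1 by apply/ltW/rot_lt1_lt; rewrite rb; case/andP: tV.
exists a, b; split=> //.
pose e (i : int) : R := (i%:~R + 3 / 4) / q%:R.
pose S K := (\sum_(k < K) beta k)%N.
have eD (i l : int) : e (i + l * q) = e i + l%:~R.
  by rewrite /e intrD intrM -pmulrn; field; rewrite gt_eqF.
have orbit K : e (K%:Z * p) + (S K)%:R <= steps a b beta K (e 0).
  elim: K => [|K IHK]; first by rewrite /S big_ord0 mul0r addr0.
  pose j := `|(K%:Z * p %% q)%Z|%N.
  have qn0 : q%:Z != 0 by rewrite eqz_nat -lt0n.
  have jE : j%:Z = (K%:Z * p %% q)%Z by rewrite /j gez0_abs // modz_ge0.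
  have jq : (j < q)%N by rewrite -ltz_nat jE ltz_pmod // ltz_nat.
  have Kju : K = j * u %[mod q].
    by apply/(inverse_mod _ _ up); rewrite jE modz_mod.
  pose l := (K%:Z * p %/ q)%Z.
  have Kp : K%:Z * p = j%:Z + l * q by rewrite jE addrC -divz_eq.
  have back : (j%:R + 4^-1) / q%:R + (beta K)%:R <= (b ^+ beta K)%g (e j).
    have := bE j jq; rewrite -{2}(subnK (betaM j K jq Kju)) expgnDr homeoM_app.
    have := iter_le_nat (M j - beta K) ((b ^+ beta K)%g (e j)) b1.
    by rewrite natrB ?betaM // /e -pmulrn; lra.
  have -> : S K.+1 = (S K + beta K)%N by rewrite /S big_ord_recr.
  rewrite /=.
  apply: (@le_trans _ _ (a ((j%:~R + 4^-1) / q%:R + (l + S K + beta K)%:~R))).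
    rewrite homeo_intD aE intS mulrDl mul1r Kp addrA -/(e _) (addrC p) eD.
    by rewrite !intrD -!pmulrn natrD; lra.
  rewrite homeo_le.
  apply: (@le_trans _ _ ((b ^+ beta K)%g (e (K%:Z * p) + (S K)%:R))).
    by rewrite homeo_natD Kp eD homeo_intD !intrD -!pmulrn; move: back; lra.
  by rewrite homeo_le.
have rq : (h%:Z * p + q%:Z * (S h)%:Z)%:~R <= q%:R * rot (steps a b beta h).
  rewrite -rotX; apply: (@rot_ge_of_point _ _ (e 0)); rewrite -steps_periodic //.
  apply: le_trans (orbit (q * h)%N); rewrite /S sum_periodic // -/(S h).
  have -> : (q * h)%:Z * p = 0 + (h%:Z * p) * q by rewrite PoszM; ring.
  by rewrite eD intrD !intrM -!pmulrn natrM; lra.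
rewrite -(ler_pM2l q0'); apply: le_trans rq.
rewrite intrD !intrM -!pmulrn le_eqVlt; apply/orP; left; apply/eqP.
by field; rewrite gt_eqF.
Qed.

End Constructions.

(** * The fringe formula *)

Theorem theorem3p1 (R : realType) (w : freeF)
  (w_pos : positive w)
  (w_not_a : forall n : nat, w <> (gen_a ^+ n)%g)
  (w_not_b : forall n : nat, w <> (gen_b ^+ n)%g) :
  exists sigma : nat -> rat,
    (forall g : nat, (0 < g)%N -> (g %| h_a w)%N ->
       0 < sigma g /\ g%:R * sigma g \is a Num.int) /\
    (forall (p : int) (q : nat), (1 <= q)%N -> coprime `|p|%N q ->
       is_fringe_length R w (p%:~R / q%:R)
         (1 / (sigma (gcdn q (h_a w)) * q%:R))).
Proof.
have [beta [ha0 hb0 hbE per rotE]] := @positive_steps R w w_pos w_not_a w_not_b.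
move: ha0 hbE per rotE; set h := h_a w => h0 hbE per rotE.
pose total g := (\sum_(c < g) longest_run h beta g c)%N.
have total0 g : (g %| h)%N -> (0 < total g)%N.
  by move=> gh; apply: longest_run_gt0; rewrite -?hbE.
exists (fun g => (total g)%:R / g%:R); split=> [g g0 gh|p q q0 cop].
  rewrite divr_gt0 ?ltr0n ?total0 // mulrC divfK ?pnatr_eq0 -?lt0n //.
have [u up] := exists_inverse_mod q0 cop.
set g := gcdn q h.
have [gq gh] : (g %| q)%N /\ (g %| h)%N by rewrite dvdn_gcdl dvdn_gcdr.
have g0 : (0 < g)%N by exact: dvdn_gt0 gq.
pose M j := longest_run h beta g ((j * u) %% g).
pose V := (\sum_(j < q) M j)%N.
have VE : (g * V = q * total g)%N by exact: (sum_residues (longest_run h beta g) q0 gq up).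
have V0 : (0 < V)%N.
  by have : (0 < g * V)%N; [rewrite VE muln_gt0 q0 total0 | rewrite muln_gt0 => /andP[]].
have sV : (total g)%:R / g%:R * q%:R = V%:R :> rat.
  rewrite mulrAC -natrM mulnC -VE mulnC natrM mulfK // pnatr_eq0 -lt0n //.
have Vinv : 0 < (V%:R^-1 : rat) <= 1 
  by rewrite invr_gt0 ltr0n V0 invf_le1 ?ltr0n // ler1n.
have rpq : ratr (p%:~R / q%:R) = p%:~R / q%:R :> R.
  by rewrite fmorph_div rmorph_int rmorph_nat.
have rs : ratr (1 - V%:R^-1) = 1 - V%:R^-1 :> R.
  by rewrite rmorphB rmorph1 fmorphV rmorph_nat.
have qn0 : q%:R != 0 :> R by rewrite pnatr_eq0 -lt0n.
rewrite sV div1r; exists (1 - V%:R^-1); split; last by rewrite subKr.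
- split=> [|t]; first by case/andP: Vinv => ? ?; apply/andP; split; lra.
  rewrite rs rpq => tV.
  have upper (rho : {multiplicative freeF -> homeo R}) :
      Defs.rot (rho gen_a) = p%:~R / q%:R -> Defs.rot (rho gen_b) = t ->
      Defs.rot (rho w) <= h%:R * (p%:~R / q%:R) + (h_b w)%:R.
    move=> ra rb; rewrite rotE hbE -ra; apply: rot_steps_le => //.
    by rewrite rb; case/andP: tV.
  split=> //.
  have [|a [b [ra rb maxw]]] := maximum_exists q0 up per _ V0 tV.
    move=> j K _ Kju; rewrite /M.
    have -> : (j * u = K %[mod g])%N.
      by rewrite -(modn_dvdm (j * u) gq) -Kju modn_dvdm.
    exact: longest_run_ge.
  have [rho [rhoa rhob]] := free_group_universal a b.
  exists rho; rewrite rhoa rhob; split=> //; apply/eqP; rewrite eq_le upper ?rhoa ?rhob //=.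
  by rewrite rotE rhoa rhob hbE.
move=> s [/andP[s0 s1] sfr].
have s1' : ratr s < 1 :> R by rewrite -(rmorph1 (@ratr R)) ltr_rat.
have [|[rho [ra rb rw]] _] := sfr (ratr s); first by rewrite lexx.
rewrite -(ler_rat R) rs.
have : V%:R - 1 <= V%:R * (ratr s : R).
  rewrite -rb; apply: (@rot_ge_of_maximum R (rho gen_a) _ beta h q u p M) => //.
  - move=> j; have := ltn_pmod (j * u) g0.
    move=> /(longest_run_attained beta h0 gh)[k Mk kju].
    have [K [Kju Kk]] : exists K, K = j * u %[mod q] /\ K = k %[mod h].
      by apply: chinese_gcd; rewrite // kju modn_mod.
    exists K => //; rewrite /M Mk.
    by rewrite (periodic_mod K per) Kk -(periodic_mod k per).
  - by rewrite ra rpq mulrC divfK.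
  - by rewrite rb.
  - by rewrite -rotE rw ra -hbE.
rewrite -ler_pdivrMl ?ltr0n // mulrBr mulr1 mulVf // pnatr_eq0 -lt0n //.
Qed.
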